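(* Let $\Omega$ be a linear order with $|\Omega| \leq \mathfrak{c}$, let $n \geq 2$ be an integer, and let $P \leq \mathrm{Aut}(\Omega)$ be $n$-transitive, closed under piecewise patching and closed under disjoint patching. Then for every cardinal $\lambda$ with $|\Omega| \leq \lambda \leq \mathfrak{c}$, the free group $G_\lambda$ of rank $\lambda$ can be represented as a pathological $n$-transitive permutation group within $P$; that is, $P$ has a subgroup isomorphic to $G_\lambda$ which is pathological and $n$-transitive on $\Omega$. In particular, any large subgroup of $\mathrm{Aut}(\mathbb{Q})$ contains a pathological $\omega$-transitive representation of $G_\lambda$ for every cardinal $\lambda$ with $\aleph_0 \leq \lambda \leq \mathfrak{c}$, and any large subgroup of $\mathrm{Aut}(\mathbb{R})$ contains a pathological $\omega$-transitive representation of $G_{\mathfrak{c}}$.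
   Context: $\mathfrak{c} = 2^{\aleph_0}$. $\Omega=(\Omega,\leq)$ is a linear order with more than two points and $\mathrm{Aut}(\Omega)$ is its group of order-automorphisms; $\mathbb{Q}$ and $\mathbb{R}$ carry their usual orders. $G_\lambda$ is the free group of rank $\lambda$. A representation of a group $G$ within a permutation group $P$ means a subgroup of $P$ isomorphic to $G$ (a faithful representation). All tuples are ordered (strictly increasing). A group $P \leq \mathrm{Aut}(\Omega)$ is $k$-transitive if for any $a_1<\dots<a_k$ and $b_1<\dots<b_k$ in $\Omega$ there is $f\in P$ with $f(a_i)=b_i$ for all $i$. It is $\omega$-transitive if it is $k$-transitive for all $k\in\mathbb{N}$, and doubly transitive if it is $2$-transitive. $\mathrm{supp}(g)=\{x\in\Omega : g(x)\neq x\}$. $P$ is pathological if it contains no non-identity element of bounded support (bounded: contained in $[a,b]$ for some $a,b\in\Omega$). $P$ is closed under piecewise patching if, whenever $S\subseteq\Omega$ is convex, $\{a_i\mid i\in\mathbb{Z}\}$ and $\{b_i\mid i\in\mathbb{Z}\}$ are coterminal (unbounded above and below) sequences in $S$ with $a_i<a_{i+1}$ and $b_i<b_{i+1}$, and for every $i\in\mathbb{Z}$ there is $g_i\in P$ with $g_i([a_i,a_{i+1}])=[b_i,b_{i+1}]$, then $P$ contains an element $g$ that is the identity outside $S$ and satisfies $g(x)=g_i(x)$ for $x\in[a_i,a_{i+1}]$. $P$ is closed under disjoint patching if for every family $(g_i)_{i\in I}$ in $P$ with $\mathrm{supp}(g_i)\cap\mathrm{supp}(g_j)=\emptyset$ for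 $i\ne j$, there is $g\in P$ with $g(x)=g_i(x)$ if $x\in\mathrm{supp}(g_i)$ and $g(x)=x$ otherwise. A subgroup of $\mathrm{Aut}(\Omega)$ is large if it is doubly transitive, is an $l$-subgroup (closed under pointwise maximum and minimum), and is closed under piecewise patching and disjoint patching.
   Formalization: The first part assumes that Ω has more than n points; for 2 < |Ω| ≤ n the claim is false, since Aut(Ω) is trivial and n-transitive (at most one increasing n-tuple) and cannot contain a free group of rank λ ≥ |Ω|. *)

(* Defs.v *)
From HB Require Import structures.
From mathcomp Require Import all_boot all_order all_algebra.
From mathcomp Require Import boolp classical_sets functions cardinality.
From mathcomp Require Import set_interval reals.

Set Implicit Arguments.
Unset Strict Implicit.
Unset Printing Implicit Defensive.
Import Order.TTheory.

Local Open Scope classical_set_scope.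
Local Open Scope group_scope.

(* FreeGroup L is the group of reduced words in the letters (x, true), standing *)
(* for x, and (x, false), standing for x^-1, where x : L. It is free with basis *)
(* free_gen (lemma free_group_universal), so its rank is the cardinal of L.     *)
Section FreeGroup.
Variable L : choiceType.
Implicit Types (x y : L * bool) (u v w : seq (L * bool)).

Definition inv_letter x := (x.1, ~~ x.2).

Definition reduced w := sorted (fun x y => y != inv_letter x) w.

Record FreeGroup := MkFree { word : seq (L * bool); word_reduced : reduced word }.

HB.instance Definition _ := [isSub for word].
HB.instance Definition _ := [Choice of FreeGroup by <:].

Definition push x w :=
  if w is y :: w' then (if y == inv_letter x then w' else x :: w) else [:: x].

Definition mul_word u v := foldr push v u.

Definition inv_word u := rev (map inv_letter u).

Lemma inv_letterK : involutive inv_letter.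
Proof. by case=> x b; rewrite /inv_letter /= negbK. Qed.

Lemma reduced_push x w : reduced w -> reduced (push x w).
Proof.
case: w => [//|y w] rw; rewrite /push; case: ifPn => h; last by rewrite /= h.
exact: path_sorted rw.
Qed.

Lemma reduced_mul u v : reduced v -> reduced (mul_word u v).
Proof. by move=> rv; elim: u => //= x u; exact: reduced_push. Qed.

Lemma reduced_inv u : reduced u -> reduced (inv_word u).
Proof.
rewrite /reduced /inv_word rev_sorted sorted_map.
congr is_true; apply: eq_sorted => x y /=.
by rewrite inv_letterK eq_sym (inv_eq inv_letterK).
Qed.

Lemma push_cancel x w : reduced w -> push x (push (inv_letter x) w) = w.
Proof.
case: w => [|y w] rw /=; first by rewrite eqxx.
rewrite inv_letterK; case: eqP => [yx|_] /=; last by rewrite eqxx.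
case: w rw => [|z w] /= => [_|/andP[h _]]; first by rewrite yx.
by rewrite -yx (negPf h).
Qed.

Lemma mul_push x u v : reduced u -> reduced v ->
  mul_word (push x u) v = push x (mul_word u v).
Proof.
case: u => [//|y u] ru rv /=; case: eqP => [->|//].
by rewrite push_cancel//; exact: reduced_mul.
Qed.

Lemma mul_wordA u v w : reduced v -> reduced w ->
  mul_word u (mul_word v w) = mul_word (mul_word u v) w.
Proof.
move=> rv rw; elim: u => //= x u ->.
by rewrite mul_push//; exact: reduced_mul.
Qed.

Lemma mul_word1 u : reduced u -> mul_word u [::] = u.
Proof.
elim: u => //= x u IH /[dup] /path_sorted ru; rewrite IH //.
by case: u {IH ru} => //= y u /andP[/negPf ->].
Qed.

Lemma mul_wordV u : reduced u -> mul_word u (inv_word u) = [::].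
Proof.
suff cancel_prefix w : reduced w -> mul_word u (mul_word (inv_word u) w) = w.
  by move=> ru; rewrite -{1}(mul_word1 (reduced_inv ru)) cancel_prefix.
elim: u w => //= x u IH w rw.
rewrite /inv_word /= rev_cons -cats1 /mul_word foldr_cat /=.
rewrite -/(mul_word _ _) -/(inv_word u) -/(mul_word u _) IH ?push_cancel//.
exact: reduced_push.
Qed.

Lemma inv_wordK : involutive inv_word.
Proof.
by move=> u; rewrite /inv_word map_rev revK (mapK inv_letterK).
Qed.

Definition free_one := @MkFree [::] isT.
Definition free_mul (a b : FreeGroup) :=
  MkFree (reduced_mul (word a) (word_reduced b)).
Definition free_inv (a : FreeGroup) := MkFree (reduced_inv (word_reduced a)).

Lemma free_mulA : associative free_mul.
Proof.
by move=> a b c; apply: val_inj; apply: mul_wordA; exact: word_reduced.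
Qed.

Lemma free_mul1 : left_id free_one free_mul.
Proof. by move=> a; apply: val_inj. Qed.

Lemma free_1mul : right_id free_one free_mul.
Proof. by move=> a; apply: val_inj; apply: mul_word1; exact: word_reduced. Qed.

Lemma free_mulVr : right_inverse free_one free_inv free_mul.
Proof. by move=> a; apply: val_inj; apply: mul_wordV; exact: word_reduced. Qed.

Lemma free_mulVl : left_inverse free_one free_inv free_mul.
Proof.
move=> a; apply: val_inj => /=.
rewrite -{2}(inv_wordK (word a)); apply: mul_wordV.
by apply: reduced_inv; exact: word_reduced.
Qed.

HB.instance Definition _ := isGroup.Build FreeGroup
  free_mulA free_mul1 free_1mul free_mulVl free_mulVr.

Definition free_gen (x : L) : FreeGroup := @MkFree [:: (x, true)] isT.

Variables (G : groupType) (h : L -> G).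

Definition eval_letter x : G := if x.2 then h x.1 else (h x.1)^-1.

Definition eval_word u : G := foldr (fun x g => eval_letter x * g) 1 u.

Definition free_lift (a : FreeGroup) : G := eval_word (word a).

Lemma eval_letterV x : eval_letter (inv_letter x) = (eval_letter x)^-1.
Proof. by case: x => x [] //; rewrite /eval_letter /= invgK. Qed.

Lemma eval_push x w : eval_word (push x w) = eval_letter x * eval_word w.
Proof.
case: w => //= y w; case: eqP => [->|//].
by rewrite eval_letterV mulVKg.
Qed.

Lemma free_liftM : {morph free_lift : a b / a * b}.
Proof.
move=> a b; rewrite /free_lift -[word (a * b)]/(mul_word (word a) (word b)).
by elim: (word a) => [|x u IH] /=; rewrite ?mul1g// eval_push IH mulgA.
Qed.

HB.instance Definition _ := isMultiplicative.Build FreeGroup G free_lift free_liftM.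

Lemma free_group_universal :
  exists f : {multiplicative FreeGroup -> G},
    (forall x : L, f (free_gen x) = h x) /\
    (forall f' : {multiplicative FreeGroup -> G},
       (forall x : L, f' (free_gen x) = h x) -> f' =1 f).
Proof.
exists free_lift; split=> [x|f' f'h]; first exact: mulg1.
have f'1 : f' 1 = 1 by apply: (mulgI (f' 1)); rewrite -gmulfM !mulg1.
have f'V a : f' a^-1 = (f' a)^-1.
  by apply: (mulgI (f' a)); rewrite -gmulfM !mulgV.
have f'l x r : f' (@MkFree [:: x] r) = eval_letter x.
  case: x r => x [] r; rewrite /eval_letter /= -f'h -?f'V; congr (f' _);
  exact: val_inj.
case; elim=> [|x u IH] r; first by rewrite -[RHS]f'1; congr (f' _); exact: val_inj.
have ru : reduced u := path_sorted r.
rewrite -[RHS]/(eval_letter x * free_lift (MkFree ru)) -IH.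
rewrite -(f'l x isT) -gmulfM; congr (f' _); apply: val_inj => /=.
by case: u {IH ru} r => //= y u /andP[/negPf ->].
Qed.

End FreeGroup.

Section Automorphisms.
Context {d : Order.disp_t} (T : orderType d).

Definition is_aut (f : T -> T) := {mono f : x y / (x <= y)%O} /\ bijective f.

Record aut := MkAut { aut_fun :> T -> T; aut_subproof : `[< is_aut aut_fun >] }.

HB.instance Definition _ := [isSub for aut_fun].
HB.instance Definition _ := [Choice of aut by <:].

Lemma autP (f : aut) : is_aut f. Proof. exact/asboolP/aut_subproof. Qed.

Lemma is_aut_id : is_aut id. Proof. by split=> //; exists id. Qed.

Lemma is_aut_comp f g : is_aut f -> is_aut g -> is_aut (f \o g).
Proof.
move=> [fm fb] [gm gb]; split; last exact: bij_comp.
by move=> x y /=; rewrite fm gm.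
Qed.

Lemma aut_inv_subproof (f : aut) : {g | is_aut g /\ cancel f g /\ cancel g f}.
Proof.
apply: cid; case: (autP f) => fm [g fg gf]; exists g; split=> //; split.
  by move=> x y; rewrite -fm !gf.
by exists f.
Qed.

Definition aut_one := MkAut (asboolT is_aut_id).
Definition aut_mul (f g : aut) :=
  MkAut (asboolT (is_aut_comp (autP f) (autP g))).
Definition aut_inv (f : aut) :=
  MkAut (asboolT (svalP (aut_inv_subproof f)).1).

Lemma aut_mulA : associative aut_mul. Proof. by move=> f g h; exact: val_inj. Qed.
Lemma aut_mul1 : left_id aut_one aut_mul. Proof. by move=> f; exact: val_inj. Qed.
Lemma aut_1mul : right_id aut_one aut_mul. Proof. by move=> f; exact: val_inj. Qed.

Lemma aut_mulVl : left_inverse aut_one aut_inv aut_mul.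
Proof.
move=> f; apply: val_inj; apply/funext => x.
exact: (svalP (aut_inv_subproof f)).2.1.
Qed.

Lemma aut_mulVr : right_inverse aut_one aut_inv aut_mul.
Proof.
move=> f; apply: val_inj; apply/funext => x.
exact: (svalP (aut_inv_subproof f)).2.2.
Qed.

HB.instance Definition _ := isGroup.Build aut
  aut_mulA aut_mul1 aut_1mul aut_mulVl aut_mulVr.

End Automorphisms.

Definition subgroup (G : groupType) (P : set G) := group_closed [in P].

Definition isomorphic_to (G K : groupType) (H : set K) :=
  exists f : {multiplicative G -> K}, injective f /\ range f = H.

Section PermutationGroups.
Context {d : Order.disp_t} {T : orderType d}.
Implicit Types (P : set (aut T)) (S : set T) (f g : aut T).

Definition ktransitive (k : nat) P :=
  forall a b : 'I_k -> T,
    {homo a : i j / (i < j)%N >-> (i < j)%O} ->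
    {homo b : i j / (i < j)%N >-> (i < j)%O} ->
    exists2 f, P f & forall i, f (a i) = b i.

Definition omega_transitive P := forall k, ktransitive k P.

Definition supp f : set T := [set x | f x != x].

Definition order_bounded S := exists a b : T, S `<=` `[a, b].

Definition pathological P := forall f, P f -> order_bounded (supp f) -> f = 1.

Definition order_convex S :=
  forall x y z : T, S x -> S z -> (x <= y <= z)%O -> S y.

Definition coterminal S (a : int -> T) :=
  (forall i, S (a i)) /\
  (forall x, S x -> (exists i, (x < a i)%O) /\ (exists i, (a i < x)%O)).

Definition closed_piecewise P :=
  forall (S : set T) (a b : int -> T) (g : int -> aut T),
    order_convex S -> coterminal S a -> coterminal S b ->
    (forall i : int, (a i < a (i + 1)%R)%O) ->
    (forall i : int, (b i < b (i + 1)%R)%O) ->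
    (forall i : int, P (g i)) ->
    (forall i : int, g i @` `[a i, a (i + 1)%R] = `[b i, b (i + 1)%R]) ->
    exists h : aut T, [/\ P h,
      (forall x, ~ S x -> h x = x) &
      (forall (i : int) x, x \in `[a i, a (i + 1)%R] -> h x = g i x)].

Definition closed_disjoint P :=
  forall (I : Type) (g : I -> aut T),
    (forall i, P (g i)) ->
    (forall i j, i <> j -> supp (g i) `&` supp (g j) = set0) ->
    exists h : aut T, [/\ P h,
      (forall i x, supp (g i) x -> h x = g i x) &
      (forall x, (forall i, ~ supp (g i) x) -> h x = x)].

Definition l_closed P :=
  forall f g, P f -> P g ->
    (exists2 h, P h & forall x, h x = Order.max (f x) (g x)) /\
    (exists2 h, P h & forall x, h x = Order.min (f x) (g x)).

Definition large P :=
  [/\ subgroup P, ktransitive 2 P, l_closed P, closed_piecewise P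
    & closed_disjoint P].

End PermutationGroups.

Definition representation_within d (T : orderType d) (G : groupType)
    (P H : set (aut T)) :=
  [/\ subgroup H, H `<=` P & isomorphic_to G H].

Notation continuum := [set: nat -> bool].

(* Main.v *)
(* Put independent actions near infinity to get freeness, and prescribe the    *)
(* generators on bounded sets to get transitivity.                             *)
(*                                                                             *)
(* Patching along the orbit of an h in P with h p = a and h a = q shows that P *)
(* contains an element supported in ]p, q[ that sends a to any b in ]p, q[;    *)
(* composing such elements realises every finite increasing partial map inside *)
(* an interval. Hence a nonempty reduced word w can be made to act             *)
(* nontrivially inside any interval: choose y_0 < ... < y_k there and let the  *)
(* letters of w carry y_0 along this chain. Cutting ]u, v[ into countably many *)
(* intervals, indexed by a length m and a word w over the bit strings of       *)
(* length m, and letting l in L <= 2^N act on the interval of (m, w) as its    *)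
(* truncation to m bits does, gives a faithful action of the free group on L   *)
(* inside ]u, v[ alone.                                                        *)
(*                                                                             *)
(* By Zorn's lemma there are pairwise disjoint such intervals that are         *)
(* unbounded above, whatever the cofinality of Omega. The generator g_l is a   *)
(* bounded element b_l below some v_l, followed by the faithful actions on the *)
(* intervals beyond v_l. A word involves finitely many letters, so a           *)
(* nontrivial one moves points beyond any bound.                               *)
(*                                                                             *)
(* Fix c < c'. For each x some b_l sends x to c if x < c, sends x to c' and    *)
(* fixes all points <= c if x > c, and sends c' to c if x = c. Bringing the    *)
(* points of a tuple to c one after the other, from the smallest one up, moves *)
(* it to a position that depends only on its length. So one generator for each *)
(* point of Omega suffices for transitivity of every degree.                   *)

Require Import Defs.
From HB Require Import structures.
From mathcomp Require Import all_boot all_order all_algebra.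
From mathcomp Require Import boolp classical_sets functions cardinality.
From mathcomp Require Import set_interval reals.

Set Implicit Arguments.
Unset Strict Implicit.
Unset Printing Implicit Defensive.
Import Order.TTheory.

Local Open Scope classical_set_scope.
Local Open Scope group_scope.

(** Freeness comes from the behaviour near infinity, transitivity from the behaviour on bounded
    sets, and disjoint patching glues the two. Double transitivity and piecewise patching yield
    [bump] and [bumps], which realise finite increasing partial maps inside any interval;
    [faithful_block] turns them into a faithful action of the free group inside one interval.
    [generators] repeats such actions on intervals unbounded above, so a nontrivial word moves
    points above every bound. This single fact gives both injectivity and pathology in
    [free_representation]. The bounded parts of the generators bring all increasing tuples of a
    given length to one position, so the same group is transitive of every degree.
    [ktransitive_nomax] and [ktransitive2] reduce degree n to double transitivity on an order
    without a largest point. *)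

Lemma free_lift1 (L : choiceType) (G : groupType) (h : L -> G) : free_lift h 1 = 1.
Proof. by []. Qed.

HB.instance Definition _ (L : choiceType) (G : groupType) (h : L -> G) :=
  Multiplicative_isUMagmaMorphism.Build (FreeGroup L) G (free_lift h) (free_lift1 h).

(** * Automorphisms, supports and the local action of words *)

Section AutFacts.
Context {d : Order.disp_t} {T : orderType d}.
Implicit Types (f g : aut T) (x y : T) (D : set T).

Lemma autK f : cancel f (f^-1)%g.
Proof. by move=> x; rewrite -[LHS]/((f^-1 * f) x) mulVg. Qed.

Lemma autVK f : cancel (f^-1)%g f.
Proof. by move=> x; rewrite -[LHS]/((f * f^-1) x) mulgV. Qed.

Lemma aut_inj f : injective f.
Proof. exact: can_inj (autK f). Qed.

Lemma aut_le f : {mono f : x y / (x <= y)%O}.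
Proof. exact: (autP f).1. Qed.

Lemma aut_lt f : {mono f : x y / (x < y)%O}.
Proof. exact: leW_mono (aut_le f). Qed.

Lemma aut_image_itv f x y : f @` `[x, y] = `[f x, f y].
Proof.
apply/seteqP; split=> [_ [z /= zxy <-]|z /= zxy].
  by rewrite /= in_itv /= !aut_le; rewrite in_itv in zxy.
exists (f^-1 z); last exact: autVK.
rewrite /= in_itv /= -(aut_le f) -(aut_le f _ y) autVK.
by rewrite in_itv in zxy.
Qed.

Lemma supp1 : supp (1 : aut T) = set0.
Proof. by apply/seteqP; split=> // x /=; rewrite /supp /= eqxx. Qed.

Lemma nsupp D f x : supp f `<=` D -> ~ D x -> f x = x.
Proof. by move=> fD nDx; apply/eqP/negPn/negP => /fD. Qed.

Lemma supp_stable D f x : supp f `<=` D -> D x -> D (f x).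
Proof.
move=> fD Dx; apply: contrapT => nD.
by apply: (nD); rewrite (aut_inj (nsupp fD nD)).
Qed.

Lemma suppV f : supp f^-1 `<=` supp f.
Proof. by move=> x; apply: contra_neq => {1}<-; exact: autK. Qed.

Lemma suppM D f g : supp f `<=` D -> supp g `<=` D -> supp (f * g) `<=` D.
Proof.
move=> fD gD x fgx; apply: contrapT => nDx; move/eqP: fgx; apply.
by rewrite -[LHS]/(f (g x)) (nsupp gD nDx) (nsupp fD nDx).
Qed.

(** D is stable under every [r2 l], so the word never leaves it and the values of [r1] outside D do
    not matter. This lets patched generators be replaced by the action planted on one interval. *)
Lemma eval_word_local (L : choiceType) D (r1 r2 : L -> aut T)
    (w : seq (L * bool)) :
  (forall l, supp (r2 l) `<=` D) ->
  (forall z, z \in w -> forall x, D x -> r1 z.1 x = r2 z.1 x) ->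
  forall x, D x -> D (eval_word r2 w x) /\ eval_word r1 w x = eval_word r2 w x.
Proof.
move=> r2D; elim: w => [//|z w IH] r12 x Dx.
have [|Dy yE] := IH _ x Dx; first by move=> t tw; apply: r12; rewrite inE tw orbT.
have {}r12 := r12 z (mem_head _ _).
rewrite -[eval_word r2 (z :: w) x]/(eval_letter r2 z (eval_word r2 w x)).
rewrite -[eval_word r1 (z :: w) x]/(eval_letter r1 z (eval_word r1 w x)) yE.
set y := eval_word r2 w x in Dy *; rewrite /eval_letter.
case: ifP => _; first by split; [exact: supp_stable|exact: r12].
have Dy' : D ((r2 z.1)^-1 y).
  by apply: supp_stable Dy; apply: subset_trans (@suppV _) (r2D _).
by split=> //; apply: (aut_inj (f := r1 z.1)); rewrite autVK r12 // autVK.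
Qed.

Lemma eval_word_map (L L' : choiceType) (k : L -> L') (r : L' -> aut T)
    (w : seq (L * bool)) :
  eval_word r [seq (k z.1, z.2) | z <- w] = eval_word (r \o k) w.
Proof. by elim: w => //= z w ->. Qed.

End AutFacts.

(** * Bi-infinite increasing sequences and orbits *)

Section IntegerSequences.
Context {d : Order.disp_t} {T : orderType d}.
Implicit Types (x y : T) (a : int -> T).

Lemma int_seq_le a : (forall i : int, (a i < a (i + 1)%R)%O) ->
  forall i j : int, (i <= j)%O -> (a i <= a j)%O.
Proof.
move=> aS i j; rewrite -[(i <= j)%O]Num.Theory.subr_ge0 => ij.
rewrite -[j](GRing.subrK i); case: (j - i)%R ij => // n _.
elim: n => [|n IH]; first by rewrite GRing.add0r.
apply: (le_trans IH); rewrite -addn1 PoszD -GRing.addrA (GRing.addrC (Posz 1)).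
by rewrite GRing.addrA; exact/ltW/aS.
Qed.

Lemma int_seq_locate a x (i j : int) : (forall i : int, (a i < a (i + 1)%R)%O) ->
  (a i <= x <= a j)%O -> exists k, (a k <= x <= a (k + 1)%R)%O.
Proof.
move=> aS /andP[ix xj]; have a_le := int_seq_le aS.
have [ji|/ltW ij] := leP j i.
  exists i; rewrite ix (le_trans xj) //.
  by rewrite (le_trans (a_le _ _ ji)) // ltW.
move: ij ix xj; rewrite -[(i <= j)%O]Num.Theory.subr_ge0 -{2}[j](GRing.subrK i).
case: (j - i)%R => // n _; elim: n i => [|n IH] i ix.
  rewrite GRing.add0r => xi; exists i; rewrite ix.
  by rewrite (le_trans xi) // ltW.
have [xi _|/ltW xi] := leP x (a (i + 1)%R); first by exists i; rewrite ix.
by rewrite -addn1 PoszD -GRing.addrA (GRing.addrC (Posz 1)); exact: IH.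
Qed.

Definition int_orbit (h : aut T) x (i : int) : T :=
  match i with Posz n => iter n h x | Negz n => iter n.+1 (h^-1)%g x end.

Lemma int_orbitS h x (i : int) : int_orbit h x (i + 1)%R = h (int_orbit h x i).
Proof.
case: i => n; first by rewrite -PoszD addn1.
by case: n => [|n]; rewrite /= autVK // subn1.
Qed.

Lemma int_orbit_lt (h : aut T) x : (x < h x)%O ->
  forall i : int, (int_orbit h x i < int_orbit h x (i + 1)%R)%O.
Proof.
move=> xh i; elim/int_rect: i => [//|n IH|n IH].
  have -> : Posz n.+1 = (Posz n + 1)%R by rewrite -PoszD addn1.
  by rewrite !int_orbitS aut_lt -int_orbitS.
have nE : (- Posz n.+1 + 1)%R = (- Posz n)%R.
  by rewrite -addn1 PoszD GRing.opprD GRing.subrK.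
by rewrite -(aut_lt h) -!int_orbitS nE.
Qed.

End IntegerSequences.

(** * Partial maps that make a reduced word move a point *)

Section Moves.
Context {d : Order.disp_t} {T : orderType d} {L : choiceType}.
Variable y : nat -> T.
Hypothesis y_incr : forall n, (y n < y n.+1)%O.
Implicit Types (w : seq (L * bool)) (a : L).

(* The partial map that must extend to the action of a for w to carry y 0 along *)
(* y 0 < y 1 < ... to y (size w). It is increasing because w is reduced.        *)
Fixpoint moves w a : seq (T * T) :=
  if w is x :: w' then
    let k := size w' in
    if x.1 == a then
      (if x.2 then (y k, y k.+1) else (y k.+1, y k)) :: moves w' a
    else moves w' a
  else [::].

Lemma moves_range p q w a : (forall n, (p < y n < q)%O) ->
  all (fun z => (p < z.1 < q)%O && (p < z.2 < q)%O) (moves w a).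
Proof.
move=> ypq; elim: w => //= x w IH; case: ifP => // _ /=.
by rewrite IH andbT; case: ifP => _; rewrite !ypq.
Qed.

(** The last two clauses recover the sign of the first letter from a move that touches the top
    point; [moves_pairwise] compares it with the letter put in front. *)
Lemma moves_le w a z : z \in moves w a ->
  [/\ (z.1 <= y (size w))%O, (z.2 <= y (size w))%O,
      z.1 = y (size w) -> ohead w = Some (a, false) &
      z.2 = y (size w) -> ohead w = Some (a, true)].
Proof.
elim: w => //= x w IH.
have lt_move u : (u <= y (size w))%O -> (u < y (size w).+1)%O.
  by move=> /le_lt_trans; apply; exact: y_incr.
have old : z \in moves w a -> (z.1 < y (size w).+1)%O /\ (z.2 < y (size w).+1)%O.
  by move=> /IH[? ? _ _]; split; exact: lt_move.
have oldC : z \in moves w a ->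
  [/\ (z.1 <= y (size w).+1)%O, (z.2 <= y (size w).+1)%O,
      z.1 = y (size w).+1 -> Some x = Some (a, false) &
      z.2 = y (size w).+1 -> Some x = Some (a, true)].
  move=> /old[z1 z2]; split; [exact: ltW|exact: ltW| |] => zE; exfalso.
    by rewrite zE ltxx in z1.
  by rewrite zE ltxx in z2.
case: eqP => [xa|//]; rewrite inE => /orP[/eqP ->|//].
have yS := y_incr (size w); rewrite -xa; case: x xa {oldC} => x [] /= _.
  by split=> // [|yE]; [exact: ltW|rewrite yE ltxx in yS].
by split=> // [|yE]; [exact: ltW|rewrite yE ltxx in yS].
Qed.

(** Two moves of a could share a source or a target only if they came from adjacent mutually inverse
    letters, which a reduced word does not have. *)
Lemma moves_pairwise w a : reduced w ->
  pairwise (fun z t => (t.1 < z.1)%O && (t.2 < z.2)%O) (moves w a).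
Proof.
elim: w => // x w IH rw; have {}IH := IH (path_sorted rw).
rewrite /=; case: eqP => [xa|//] /=; rewrite IH andbT.
apply/allP => t /moves_le[t1 t2 e1 e2].
have yS := y_incr (size w).
case: x xa rw => x [] /= -> rw.
  rewrite (le_lt_trans t2 yS) andbT lt_neqAle t1 andbT.
  by apply/eqP => /e1; case: w rw {IH t1 t2 e1 e2 yS} => //= z w /andP[/eqP ? _] [].
rewrite (le_lt_trans t1 yS) /= lt_neqAle t2 andbT.
by apply/eqP => /e2; case: w rw {IH t1 t2 e1 e2 yS} => //= z w /andP[/eqP ? _] [].
Qed.

Lemma moves_eval w (r : L -> aut T) :
  (forall a z, z \in moves w a -> r a z.1 = z.2) ->
  eval_word r w (y 0) = y (size w).
Proof.
elim: w => // x w IH rw.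
rewrite -[LHS]/(eval_letter r x (eval_word r w (y 0))) IH; last first.
  move=> a z zw; apply: rw => /=; case: ifP => // _.
  by rewrite inE zw orbT.
have /= := rw x.1; rewrite eqxx => /(_ _ (mem_head _ _)).
rewrite /eval_letter; case: x.2 => //= <-; exact: autK.
Qed.

End Moves.

(** * Elements of [P] with prescribed values inside an interval *)

Section Patching.
Context {d : Order.disp_t} {T : orderType d} (P : set (aut T)).
Hypothesis P_sub : subgroup P.
Hypothesis P_trans : ktransitive 2 P.
Hypothesis nomax : forall x : T, exists y, (x < y)%O.
Hypothesis P_piece : closed_piecewise P.
Hypothesis P_disj : closed_disjoint P.

Lemma P1 : P 1.
Proof. by case: P_sub => /set_mem. Qed.

Lemma PV f : P f -> P f^-1.
Proof.
by move=> Pf; rewrite -(mul1g f^-1); apply/set_mem/P_sub.2; apply: mem_set => //; exact: P1.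
Qed.

Lemma PM f g : P f -> P g -> P (f * g).
Proof.
move=> Pf Pg; rewrite -(invgK g); apply/set_mem/P_sub.2; apply: mem_set => //.
exact: PV.
Qed.

Lemma P_trans2 (a1 a2 b1 b2 : T) : (a1 < a2)%O -> (b1 < b2)%O ->
  exists f, [/\ P f, f a1 = b1 & f a2 = b2].
Proof.
move=> a12 b12; pose t (x y : T) (i : 'I_2) := if (i : nat) is 0 then x else y.
have tmono x y : (x < y)%O -> {homo t x y : i j / (i < j)%N >-> (i < j)%O}.
  by move=> xy [[|[|i]] ?] [[|[|j]] ?].
have [f Pf fE] := P_trans (tmono _ _ a12) (tmono _ _ b12).
by exists f; split=> //; [have := fE ord0|have := fE ord_max].
Qed.

Lemma P_trans1 a b : exists2 f, P f & f a = b.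
Proof.
have [[a' aa'] [b' bb']] := (nomax a, nomax b).
by have [f [Pf fE _]] := P_trans2 aa' bb'; exists f.
Qed.

Lemma dense_order (x y : T) : (x < y)%O -> exists2 z, (x < z)%O & (z < y)%O.
Proof.
move=> xy; have [z yz] := nomax y; have [f [Pf fx fz]] := P_trans2 (lt_trans xy yz) xy.
by exists (f y); [rewrite -{1}fx|rewrite -{2}fz]; rewrite aut_lt.
Qed.

Lemma nomin (x : T) : exists y, (y < x)%O.
Proof.
have [y xy] := nomax x; have [f _ fy] := P_trans1 y x.
by exists (f x); rewrite -{2}fy aut_lt.
Qed.

Lemma increasing_seq (p q : T) : (p < q)%O ->
  exists y : nat -> T, (forall n, (y n < y n.+1)%O) /\ (forall n, (p < y n < q)%O).
Proof.
move=> pq; have /choice[s sP] : forall x, exists z, (x < q)%O -> (x < z < q)%O.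
  move=> x; have [xq|] := pselect (x < q)%O; last by move=> ?; exists x.
  by have [z xz zq] := dense_order xq; exists z; rewrite xz.
have yq n : (p < iter n.+1 s p < q)%O.
  elim: n => [|n /andP[pz zq]]; first exact: sP.
  by have /andP[zz' ->] := sP _ zq; rewrite (lt_trans pz zz').
exists (fun n => iter n.+1 s p); split=> // n.
by have /andP[_ /sP /andP[]] := yq n.
Qed.

(** The patch agrees with [r j] on all of [D j], fixed points included, which is the form that
    [eval_word_local] needs. *)
Lemma patch_family (J : Type) (D : J -> set T) (r : J -> aut T) :
  (forall i j, i <> j -> D i `&` D j = set0) ->
  (forall j, P (r j)) -> (forall j, supp (r j) `<=` D j) ->
  exists h, [/\ P h, forall j x, D j x -> h x = r j x
    & forall x, (forall j, ~ D j x) -> h x = x].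
Proof.
move=> Dij Pr rD; have [|h [Ph hr h1]] := P_disj Pr.
  move=> i j /Dij /seteqP[Dij0 _].
  by apply/seteqP; split=> // x [/rD ? /rD ?]; apply: (Dij0 x).
exists h; split=> // [j x Djx|x nD]; last by apply: h1 => j /rD; exact: nD.
have [rx|rx] := pselect (supp (r j) x); first exact: hr.
rewrite (nsupp (subset_refl (A := supp (r j))) rx) h1 // => i ix.
have [ij|/Dij /seteqP[Dij0 _]] := pselect (i = j); first by rewrite ij in ix.
by apply: (Dij0 x); split=> //; exact: rD.
Qed.


(** Piecewise patching needs sequences coterminal in a convex set. The orbit of p under an h with h
    p = a and h a = q is one in its convex hull S. Replacing its term a by b, the pieces are [f0] on
    [p, a], [f1] on [a, q] and the identity elsewhere. *)
Lemma bump (p q a b : T) : (p < a < q)%O -> (p < b < q)%O ->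
  exists f, [/\ P f, supp f `<=` [set x | (p < x < q)%O] & f a = b].
Proof.
move=> /andP[pa aq] /andP[pb bq].
have [h [_ hp ha]] := P_trans2 pa aq.
have [f0 [Pf0 f0p f0a]] := P_trans2 pa pb.
have [f1 [Pf1 f1a f1q]] := P_trans2 aq bq.
pose g_ := int_orbit h p; pose b_ (i : int) := if i == 1%R then b else g_ i.
pose f_ (i : int) : aut T := if i == 0%R then f0 else if i == 1%R then f1 else 1.
have gS : forall i : int, (g_ i < g_ (i + 1)%R)%O by apply: int_orbit_lt; rewrite hp.
have g1 : g_ 1%R = a by [].
have g2 : g_ (1 + 1)%R = q by rewrite -ha -{1}hp.
have i1E (i : int) : (i + 1 = 1)%R -> i = 0%R.
  by move=> /(canRL (GRing.addrK _)) ->; rewrite GRing.subrr.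
have b1 : b_ 1%R = b by [].
have bE i : i <> 1%R -> b_ i = g_ i by rewrite /b_; case: eqP.
have bS i : (b_ i < b_ (i + 1)%R)%O.
  have [->|i1] := eqVneq i 1%R.
    by rewrite b1 bE // -[X in (_ < X)%O]/(h (h p)) hp ha.
  have [->|i0] := eqVneq i 0%R; first by rewrite bE.
  by rewrite !bE // => [/i1E|]; apply/eqP.
pose S : set T := [set x | exists i j, (g_ i <= x <= g_ j)%O].
have neS (i : int) : (i + 1)%R != i.
  by apply/eqP => /(canRL (GRing.addKr _)); rewrite GRing.addNr.
(* The bounding index can avoid any given c; with c = 1 this makes [b_], which differs from [g_]
   only at 1, coterminal as well. *)
have S_cof x : S x -> forall c : int, (exists2 i, i != c & (x < g_ i)%O)
    /\ (exists2 i, i != c & (g_ i < x)%O).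
  move=> [i [j /andP[ix xj]]] c; split.
    have xj1 := le_lt_trans xj (gS j).
    have [jc|?] := eqVneq (j + 1)%R c; last by exists (j + 1)%R.
    exists (j + 1 + 1)%R; last exact: lt_trans (gS _).
    by rewrite -jc neS.
  have gB k : (g_ (k - 1)%R < g_ k)%O by rewrite -{2}[k](GRing.subrK 1%R).
  have ix1 := lt_le_trans (gB i) ix.
  have [ic|?] := eqVneq (i - 1)%R c; last by exists (i - 1)%R.
  exists (i - 1 - 1)%R; last exact: lt_trans (gB _) _.
  by rewrite -ic eq_sym -{1}[(i - 1)%R](GRing.subrK 1%R) neS.
have gSS i : S (g_ i) by exists i, i; rewrite lexx.
have [|||||||k [Pk kS kf]] := P_piece (S := S) (a := g_) (b := b_) (g := f_).
- move=> x y z [i [_ /andP[ix _]]] [_ [j /andP[_ zj]]] /andP[xy yz].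
  by exists i, j; rewrite (le_trans ix xy) (le_trans yz zj).
- split=> // x /S_cof /(_ 0%R) [[i _ xi] [j _ jx]].
  by split; [exists i|exists j].
- split=> [i|x /S_cof /(_ 1%R) [[i i1 xi] [j j1 jx]]].
    rewrite /b_; case: eqP => // _; exists 0%R, 2%R.
    by rewrite (ltW pb) -[g_ 2%R]/(h (h p)) hp ha ltW.
  by split; [exists i|exists j]; rewrite /b_ ifN.
- exact: gS.
- exact: bS.
- by move=> i; rewrite /f_; do 2!case: ifP => // _; exact: P1.
- move=> i; rewrite aut_image_itv /f_.
  case: eqP => [->|i0].
    by rewrite -[b_ (0 + 1)%R]/b -[b_ 0%R]/p -[g_ (0 + 1)%R]/(h p) f0p hp f0a.
  case: eqP => [->|i1]; last by rewrite !bE // => /i1E.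
  by rewrite b1 bE // -[g_ 1%R]/(h p) -[g_ (1 + 1)%R]/(h (h p)) hp ha f1a f1q.
exists k; split=> //; last first.
  rewrite (kf 0%R) // mem_setE in_itv; apply/andP; split; first exact: ltW pa.
  by rewrite -[g_ _]/(h p) hp /=.
move=> x; apply: contraPP; rewrite /= => xpq; rewrite /supp /=; apply/negP/negPn/eqP.
have [[i [j ixj]]|/kS//] := pselect (S x).
have [l xl] := int_seq_locate gS ixj.
rewrite (kf l) ?mem_setE ?in_itv // /f_.
case: eqP xl => [->|_].
  rewrite -[g_ _]/p -[g_ (0 + 1)%R]/(h p) hp.
  rewrite le_eqVlt => /andP[/orP[/eqP <- //|px] /le_lt_trans xa].
  by case: xpq; rewrite px xa.
case: eqP => [->|//]; rewrite -[g_ 1%R]/(h p) -[g_ (1 + 1)%R]/(h (h p)) hp ha.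
rewrite [(x <= q)%O]le_eqVlt => /andP[/(lt_le_trans pa) px /orP[/eqP -> //|xq]].
by case: xpq; rewrite px xq.
Qed.

(** The list decreases, so its head is the largest pair. Once f sends [z.1] to [z.2], the displaced
    remaining sources and their targets lie below [z.2], and the induction on the length continues
    inside ]p, z.2[, where it no longer affects [z.2]. *)
Lemma bumps (p q : T) (s : seq (T * T)) :
  all (fun z => (p < z.1 < q)%O && (p < z.2 < q)%O) s ->
  pairwise (fun z t => (t.1 < z.1)%O && (t.2 < z.2)%O) s ->
  exists f, [/\ P f, supp f `<=` [set x | (p < x < q)%O]
    & forall z, z \in s -> f z.1 = z.2].
Proof.
elim: {s}_.+1 {-2}s (ltnSn (size s)) q => // n IH [_ q _ _|z s sn q].
  by exists 1; split=> //; [exact: P1|rewrite supp1].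
rewrite /= => /andP[/andP[z1 z2] spq] /andP[zs ss].
have [f [Pf fpq fz]] := bump z1 z2.
have fp t : (p < t < q)%O -> (p < f t)%O.
  by move=> tpq; have /andP[] := supp_stable fpq (x := t) tpq.
have [|||g [Pg gpq gs]] := IH [seq (f t.1, t.2) | t <- s] _ z.2; first 1 last.
- apply/allP => _ /mapP[t ts ->] /=.
  have /andP[/fp pt1 /andP[pt2 _]] := allP spq _ ts.
  have /andP[tz1 tz2] := allP zs _ ts.
  by rewrite pt1 pt2 tz2 -fz aut_lt tz1.
- rewrite pairwise_map; apply: sub_pairwise ss => t t' /=.
  by rewrite aut_lt.
- exists (g * f); split; first exact: PM.
    apply: suppM => //; apply: subset_trans gpq _ => x /= /andP[-> xz].
    by case/andP: z2 => _ /(lt_trans xz).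
  move=> t; rewrite inE -[(g * f) t.1]/(g (f t.1)) => /orP[/eqP ->|ts].
    by rewrite fz; apply: nsupp gpq _; rewrite /= ltxx andbF.
  by rewrite (gs (f t.1, t.2)) //; apply/mapP; exists t.
- by rewrite size_map.
Qed.

(** * Faithful actions inside an interval *)

Lemma faithful_on_word (L : choiceType) (w : seq (L * bool)) (p q : T) :
  (p < q)%O -> exists r : L -> aut T,
    [/\ forall a, P (r a), forall a, supp (r a) `<=` [set x | (p < x < q)%O] &
      reduced w -> w <> [::] ->
      exists2 x, (p < x < q)%O & eval_word r w x <> x].
Proof.
move=> pq; have [y [yS ypq]] := increasing_seq pq.
have [rw|nrw] := boolP (reduced w); last first.
  by exists (fun=> 1); split=> // a; [exact: P1|rewrite supp1].
have /choice[r rP] a := bumps (moves_range w a ypq) (moves_pairwise yS a rw).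
exists r; split=> [a|a|_ w0]; [by case: (rP a)|by case: (rP a)|].
exists (y 0); first exact: ypq.
rewrite (@moves_eval _ _ _ y w r); last by move=> a; case: (rP a).
case: w w0 {rw rP} => // x w _ /=; apply/eqP; rewrite gt_eqF //.
have y0 n : (y 0 <= y n)%O by elim: n => // n /le_trans; apply; exact: ltW.
exact: le_lt_trans (y0 _) (yS _).
Qed.


(** L may be uncountable, but a word has finitely many letters, told apart by long enough
    truncations of their bit strings. So it suffices to handle the countably many words over finite
    bit strings, each on its own interval. *)
Lemma faithful_block (L : choiceType) (e : L -> nat -> bool) (u v : T) :
  injective e -> (u < v)%O -> exists r : L -> aut T,
    [/\ forall l, P (r l), forall l, supp (r l) `<=` [set x | (u < x < v)%O] &
      forall w, reduced w -> w <> [::] ->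
      exists2 x, (u < x < v)%O & eval_word r w x <> x].
Proof.
move=> e_inj uv; have [y [yS yuv]] := increasing_seq uv.
(* Indices that encode nothing get the empty word, for which nontriviality is not claimed. *)
pose code i : nat * seq (seq bool * bool) := odflt (0%N, [::]) (unpickle i).
have /choice[r rP] i := faithful_on_word (code i).2 (yS i).
pose tr m l := mkseq (e l) m.
have tr_inj (s : seq L) : exists m, {in s &, injective (tr m)}.
  have /choice[k kP] (z : L * L) : exists k, z.1 <> z.2 -> e z.1 k <> e z.2 k.
    have [->|z12] := pselect (z.1 = z.2); first by exists 0%N.
    have /existsNP[k zk] : ~ (e z.1 =1 e z.2) by move=> /funext /e_inj.
    by exists k.
  (* A length beyond one separating position for each pair of letters. *)
  exists (\max_(z <- [seq (l, l') | l <- s, l' <- s]) (k z).+1)%N.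
  move=> l l' ls l's lE; apply: contrapT => /(kP (l, l')); apply => /=.
  have km : (k (l, l') < \max_(z <- [seq (l, l') | l <- s, l' <- s]) (k z).+1)%N.
    by apply: (@leq_bigmax_seq _ _ xpredT (fun z => (k z).+1)) => //; apply/allpairsP; exists (l, l').
  by rewrite -(nth_mkseq false _ km) -/(tr _ _) lE nth_mkseq.
pose J i := [set x | (y i < x < y i.+1)%O].
have y_lt i j : (i < j)%N -> (y i.+1 <= y j)%O.
  by elim: j => // j IH; rewrite ltnS leq_eqVlt => /orP[/eqP -> //|/IH /le_trans]; apply; exact: ltW.
have Jij i j : i <> j -> J i `&` J j = set0.
  move=> /eqP; rewrite neq_ltn => /orP[] ij; apply/seteqP; split=> // x [/andP[ix xi] /andP[jx xj]].
    by have := lt_trans (le_lt_trans (y_lt _ _ ij) jx) xi; rewrite ltxx.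
  by have := lt_trans (le_lt_trans (y_lt _ _ ij) ix) xj; rewrite ltxx.
have Pr i a : P (r i a) by case: (rP i).
have rJ i a : supp (r i a) `<=` J i by case: (rP i).
have /choice[f fP] (l : L) := patch_family Jij
  (fun i => Pr i (tr (code i).1 l)) (fun i => rJ i (tr (code i).1 l)).
have Juv i x : J i x -> (u < x < v)%O.
  move=> /andP[ix xi]; have /andP[ui _] := yuv i; have /andP[_ iv] := yuv i.+1.
  by rewrite (lt_trans ui ix) (lt_trans xi iv).
exists f; split=> [l|l x|w rw w0]; first by case: (fP l).
  apply: contraPP => nx; rewrite /supp /=; apply/negP/negPn/eqP.
  by have [_ _] := fP l; apply=> i /Juv.
have [m m_inj] := tr_inj [seq z.1 | z <- w].
pose w' := [seq (tr m z.1, z.2) | z <- w].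
pose i := pickle (m, w').
have ci : code i = (m, w') by rewrite /code /i pickleK.
have rw' : reduced w'.
  move: rw; rewrite /reduced /w' sorted_map; apply: (sub_in_sorted (P := mem w)) => //.
    move=> [l b] [l' b'] lw l'w /=; apply: contra_neq => -[lE ->].
    by congr (_, _); apply: m_inj lE; apply/mapP; [exists (l', b')|exists (l, b)].
have [_ _] := rP i; rewrite ci /= => /(_ rw') [|x xJ wx].
  by rewrite /w'; case: (w) w0.
exists x; first exact: (Juv i).
have fJ z : z \in w -> forall t, J i t -> f z.1 t = (r i \o tr m) z.1 t.
  by move=> zw t Jt; have [_ /(_ i t Jt) -> _] := fP z.1; rewrite ci.
have [_ ->] := eval_word_local (fun l => rJ i (tr m l)) fJ xJ.
by rewrite -eval_word_map.
Qed.


(** A maximal disjoint family works: if no member started at or above c, another interval could be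
    added on top. Zorn's lemma replaces a recursion along the naturals, which would fail in
    uncountable cofinality. *)
Lemma unbounded_disjoint_intervals : exists A : set (T * T),
  [/\ forall z, A z -> (z.1 < z.2)%O,
    forall z t, A z -> A t -> z <> t -> (z.2 <= t.1)%O \/ (t.2 <= z.1)%O &
    forall c, exists2 z, A z & (c <= z.1)%O].
Proof.
pose Q (A : set (T * T)) := (forall z, A z -> (z.1 < z.2)%O) /\
  (forall z t, A z -> A t -> z <> t -> (z.2 <= t.1)%O \/ (t.2 <= z.1)%O).
have [F FQ Ftot|A [[A1 A2] Amax]] := @Zorn_bigcup _ Q.
  split=> [z [X /FQ[X1 _]]|z t [X FX Xz] [Y FY Yt] zt]; first exact: X1.
  have [XY|YX] := Ftot _ _ FX FY.
    by have [_ Y2] := FQ _ FY; apply: Y2 => //; exact: XY.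
  by have [_ X2] := FQ _ FX; apply: X2 => //; exact: YX.
exists A; split=> // c; apply: contrapT => noz.
have Ac z : A z -> (z.1 < c)%O.
  by move=> Az; rewrite ltNge; apply/negP => cz; apply: noz; exists z.
(* All members start before c, so by disjointness at most one reaches past it; k is its right end,
   or c if there is none. *)
have [k ck Ak] : exists2 k, (c <= k)%O & forall z, A z -> (z.2 <= k)%O.
  have [[z Az cz]|nz] := pselect (exists2 z, A z & (c < z.2)%O); last first.
    exists c => // z Az; rewrite leNgt; apply/negP => cz; apply: nz; by exists z.
  exists z.2; first exact: ltW.
  move=> t At; have [->//|zt] := pselect (z = t).
  have [zt2|tz] := A2 _ _ Az At zt.
    by have := lt_trans (le_lt_trans zt2 (Ac _ At)) cz; rewrite ltxx.
  exact: le_trans tz (ltW (A1 _ Az)).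
have [k' kk'] := nomax k.
have nAk : ~ A (k, k') by move=> /Ac /=; rewrite ltNge ck.
apply: (Amax (A `|` [set (k, k')])).
  split; first by move=> z; left.
  by move=> /(_ (k, k')) /= kA; apply: nAk; apply: kA; right.
split=> [z [/A1//|->//]|z t [Az|->] [At|->]] zt //.
- exact: A2.
- by left; exact: Ak.
- by right; exact: Ak.
Qed.

(* One choice of bv.1 for every x, with support below bv.2: the generators act  *)
(* on the points up to c' and x as bv.1 does.                                   *)
Lemma stepping_element (c c' : T) : (c < c')%O -> forall x, exists bv : aut T * T,
  [/\ P bv.1, supp bv.1 `<=` [set z | (z < bv.2)%O],
    (c' < bv.2)%O && (x < bv.2)%O,
    ((x < c)%O -> bv.1 x = c) /\ (x = c -> bv.1 c' = c) &
    (c < x)%O -> bv.1 x = c' /\ forall z, (z <= c)%O -> bv.1 z = z].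
Proof.
move=> cc' x; have [v vmax] : exists v, forall z, z \in [:: c'; x] -> (z < v)%O.
  have [v vmax] := nomax (Order.max c' x); exists v => z.
  by rewrite !inE => /orP[] /eqP ->; apply: le_lt_trans vmax; rewrite le_max lexx ?orbT.
have c'v : (c' < v)%O by apply: vmax; rewrite mem_head.
have xv : (x < v)%O by apply: vmax; rewrite !inE eqxx orbT.
have cv := lt_trans cc' c'v.
have sub u : [set z | (u < z < v)%O] `<=` [set z | (z < v)%O] by move=> z /andP[].
have [xc|cx|xc] := ltgtP x c.
- have [u ux] := nomin x; have [||f [Pf fs fE]] := @bump u v x c.
  + by rewrite ux.
  + by rewrite (lt_trans ux xc).
  exists (f, v); split=> //=; [exact: subset_trans fs _|by rewrite c'v|split=> // xE].
  by rewrite xE ltxx in xc.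
- have [||f [Pf fs fE]] := @bump c v x c'; [by rewrite cx|by rewrite cc'|].
  exists (f, v); split=> //=; [exact: subset_trans fs _|by rewrite c'v|split=> // xE|].
    by rewrite xE ltxx in cx.
  by split=> // z zc; apply: nsupp fs _; rewrite /= ltNge zc.
- have [u uc] := nomin c; have [||f [Pf fs fE]] := @bump u v c' c.
  + by rewrite (lt_trans uc cc').
  + by rewrite uc.
  by exists (f, v); split=> //=; [exact: subset_trans fs _|rewrite c'v].
Qed.

(** * The generators and the group they generate *)

Section Representation.
Variables (L : choiceType) (e : L -> nat -> bool) (s : L -> T) (c c' : T).
Hypothesis e_inj : injective e.
Hypothesis s_surj : forall x, exists l, s l = x.
Hypothesis cc' : (c < c')%O.

Lemma generators : exists g : L -> aut T,
  [/\ forall l, P (g l),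
    forall w, reduced w -> w <> [::] ->
      forall t, exists2 x, (t < x)%O & eval_word g w x <> x &
    forall l, [/\ (s l < c)%O -> g l (s l) = c, s l = c -> g l c' = c &
      (c < s l)%O -> g l (s l) = c' /\ forall z, (z <= c)%O -> g l z = z]].
Proof.
have [A [A1 A2 Aub]] := unbounded_disjoint_intervals.
have /choice[bv bvP] l := stepping_element cc' (s l).
have /choice[psi psiP] (z : T * T) : exists r : L -> aut T, (z.1 < z.2)%O ->
    [/\ forall l, P (r l), forall l, supp (r l) `<=` [set x | (z.1 < x < z.2)%O] &
      forall w, reduced w -> w <> [::] ->
      exists2 x, (z.1 < x < z.2)%O & eval_word r w x <> x].
  have [z12|?] := pselect (z.1 < z.2)%O; last by exists (fun=> 1).
  by have [r rP] := faithful_block e_inj z12; exists r.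
pose act l z := A z /\ ((bv l).2 <= z.1)%O.
(* [None] indexes the bounded part of the generator l; an interval not beyond its bound contributes
   the empty set. *)
pose D l (j : option (T * T)) : set T := if j is Some z then
  [set x | act l z /\ (z.1 < x < z.2)%O] else [set x | (x < (bv l).2)%O].
pose r l j : aut T := if j is Some z then (if asbool (act l z) then psi z l else 1)
  else (bv l).1.
have gP l : exists g, [/\ P g, forall j x, D l j x -> g x = r l j x
    & forall x, (forall j, ~ D l j x) -> g x = x].
  apply: patch_family => [i j|j|j].
  - case: i j => [z|] [t|] // zt; apply/seteqP; split=> // x /=.
    + move=> [[[Az _] /andP[zx xz]] [[At _] /andP[tx xt]]].
      have [|zlt|tlz] := A2 _ _ Az At; first by move=> E; apply: zt; rewrite E.
        by have := lt_trans (lt_le_trans xz zlt) tx; rewrite ltxx.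
      by have := lt_trans (lt_le_trans xt tlz) zx; rewrite ltxx.
    + move=> [[[_ vz] /andP[zx _]] xv].
      by have := lt_trans (lt_le_trans xv vz) zx; rewrite ltxx.
    + move=> [xv [[_ vz] /andP[zx _]]].
      by have := lt_trans (lt_le_trans xv vz) zx; rewrite ltxx.
  - case: j => [z|] /=; last by case: (bvP l).
    case: asboolP => [[/A1 z12 _]|_]; last exact: P1.
    by have [Pp _ _] := psiP z z12.
  - case: j => [z|] /=; last by case: (bvP l).
    case: asboolP => [za|_]; last by rewrite supp1.
    by have [_ sp _] := psiP z (A1 _ za.1); move=> x /sp.
have {gP} /choice[g gP] := gP.
exists g; split=> [l|w rw w0 t|l]; first by case: (gP l).
  (* Beyond k all the letters of w act through the planted blocks, so any block there detects w. *)
  have [k tk kw] : exists2 k, (t <= k)%O & forall z, z \in w -> ((bv z.1).2 <= k)%O.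
    elim: (w) => [|z w' [k tk kw]]; first by exists t.
    exists (Order.max k (bv z.1).2) => [|y]; rewrite le_max ?tk // inE.
    by move=> /orP[/eqP ->|/kw ->//]; rewrite lexx orbT.
  have [z Az kz] := Aub k; have [_ sp fp] := psiP z (A1 _ Az).
  have [x xz wx] := fp w rw w0; exists x.
    by case/andP: xz => zx _; apply: le_lt_trans zx; exact: le_trans kz.
  have gz y : y \in w -> forall x, (z.1 < x < z.2)%O -> g y.1 x = psi z y.1 x.
    move=> /kw yk u uz; have az : act y.1 z by split=> //; exact: le_trans kz.
    by have [_ /(_ (Some z) u) -> //= _] := gP y.1; rewrite asboolT.
  by have [_ ->] := eval_word_local sp gz xz.
have [Pb sb /andP[c'v sv] [b1 b2] b3] := bvP l.
have gb x : (x < (bv l).2)%O -> g l x = (bv l).1 x.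
  by move=> xv; have [_ /(_ None x xv)] := gP l.
rewrite !gb //; split=> // /b3[bs bz]; split=> // z zc.
by rewrite gb ?bz // (le_lt_trans zc) // (lt_trans cc').
Qed.


Lemma free_representation : exists H : set (aut T),
  [/\ representation_within (FreeGroup L) P H, pathological H & omega_transitive H].
Proof.
have [g [gP gub gs]] := generators.
set F := free_lift g.
have FM a b : F (a * b) = F a * F b by exact: gmulfM.
have FMx a b x : F (a * b) x = F a (F b x) by rewrite FM.
have FV a : F a^-1 = (F a)^-1 by exact: gmulfV.
have F_gen l : F (free_gen l) = g l by exact: mulg1.
have FP a : P (F a).
  case: a => w rw; rewrite /F /= /free_lift /=; elim: w {rw} => [|x w IH]; first exact: P1.
  by apply: PM => //; rewrite /eval_letter; case: ifP => _ //; exact: PV.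
have F_unbounded a : a <> 1 -> forall t, exists2 x, (t < x)%O & F a x <> x.
  case: a => w rw a1; apply: gub => // w0; apply: a1; exact: val_inj.
have F_path a : order_bounded (supp (F a)) -> a = 1.
  move=> [u [v uv]]; apply: contrapT => /F_unbounded /(_ v) [x vx /eqP /uv].
  by rewrite /= in_itv => /andP[_]; rewrite /= leNgt vx.
exists (range F); split; first split.
- split; first by apply/mem_set; exists 1 => //; exact: gmulf1.
  move=> _ _ /set_mem[a _ <-] /set_mem[b _ <-]; apply/mem_set.
  by exists (a / b) => //; rewrite FM FV.
- by move=> _ [a _ <-].
- exists (free_lift g); split=> //; apply: gmulf_inj => a Fa1; apply: F_path.
  by exists c, c; rewrite [F a]Fa1 supp1.
- by move=> _ [a _ <-] /F_path ->; exact: gmulf1.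
have F1 : F 1 = 1 by exact: gmulf1.
clearbody F.
(* The lists decrease, so the recursion places the smaller points before the head. *)
have canon k : exists cs, forall a : seq T, size a = k.+1 -> sorted >%O a ->
    exists h, [seq F h x | x <- a] = c :: cs.
  elim: k => [|k [cs csP]].
    exists [::] => -[|x []] // _ _; have [l lx] := s_surj x; have [gl glc gg] := gs l.
    have [xc|cx|xc] := ltgtP x c.
    - by exists (free_gen l); rewrite /= F_gen -lx gl // lx.
    - have [l0 l0c] := s_surj c; have [_ g0 _] := gs l0.
      exists (free_gen l0 * free_gen l).
      rewrite lx in gg; have [gx _] := gg cx.
      by rewrite /= FMx !F_gen gx g0.
    - by exists 1; rewrite F1 /= -xc.
  have [l0 l0c] := s_surj c; have [_ /(_ l0c) g0 _] := gs l0.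
  (* With the tail at [c :: cs], the head has gone above c. The generator of its image sends it to
     c' and fixes the tail; then the generator [l0] of c takes c' to c and the tail to a place
     independent of the list. *)
  exists [seq g l0 x | x <- c :: cs] => -[|x a] // [ak] xa.
  have [h hE] := csP a ak (path_sorted xa).
  have hsort : sorted >%O [seq F h y | y <- x :: a].
    by rewrite sorted_map; apply: sub_sorted xa => y z /=; rewrite aut_lt.
  have : sorted >%O (F h x :: c :: cs) by rewrite -hE.
  move=> /= /andP[cx]; rewrite path_sortedE; last by move=> ? ? ? /[swap]; exact: lt_trans.
  move=> /andP[/allP csc _].
  have [l lx] := s_surj (F h x); have [_ _] := gs l.
  rewrite lx => /(_ cx)[gx gfix].
  exists (free_gen l0 * (free_gen l * h)); rewrite /= !FMx !F_gen gx g0; congr (_ :: _).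
  transitivity [seq g l0 (g l y) | y <- [seq F h y | y <- a]].
    by rewrite -map_comp; apply: eq_map => y; rewrite !FMx !F_gen.
  rewrite hE; apply/eq_in_map => y; rewrite inE => yc; congr (g l0 _); apply: gfix.
  by case/orP: yc => [/eqP -> //|/csc /ltW].
move=> [|k] a b a_incr b_incr; first by exists 1 => [|[]//]; exists 1.
have [cs csP] := canon k.
have incr_list (x : 'I_k.+1 -> T) : {homo x : i j / (i < j)%N >-> (i < j)%O} ->
    exists h, forall i, F h (x i) = nth c (rev (c :: cs)) i.
  move=> x_incr; have [||h hE] := csP (rev [seq x i | i <- enum 'I_k.+1]).
  - by rewrite size_rev size_map size_enum_ord.
  - rewrite rev_sorted sorted_map; apply: sub_sorted (_ : sorted (relpre val ltn) _) => [i j|].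
      exact: x_incr.
    by rewrite -sorted_map val_enum_ord iota_ltn_sorted.
  exists h => i; rewrite -hE -map_rev revK -map_comp (nth_map ord0) ?size_enum_ord //=.
  by rewrite nth_ord_enum.
have [[h hE] [h' h'E]] := (incr_list a a_incr, incr_list b b_incr).
exists (F (h'^-1 * h)); first by exists (h'^-1 * h).
move=> i; apply: (aut_inj (f := F h')); rewrite h'E -hE.
by rewrite FMx FV autVK.
Qed.

End Representation.
End Patching.

(** * Cardinalities and reduction to double transitivity *)

Lemma card_le_injection (U V : Type) : ([set: U] #<= [set: V])%card ->
  exists f : U -> V, injective f.
Proof.
move=> /card_leP[g]; exists (fun x => val (g (SigSub (mem_set (I : setT x))))) => x y /val_inj gE.
by have [] := 'inj_g (in_setT _) (in_setT _) gE.
Qed.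

Lemma injection_surjection (U : choiceType) (V : Type) (u : U) (j : U -> V) :
  injective j -> exists s : V -> U, forall x, exists l, s l = x.
Proof.
move=> j_inj.
have /choice[s sP] v : exists x, forall y, j y = v -> x = y.
  have [[x <-]|nx] := pselect (exists x, j x = v); first by exists x => y /j_inj.
  by exists u => y yv; case: nx; exists y.
by exists s => x; exists (j x); exact: sP.
Qed.

Lemma free_representation_card d (T : orderType d) (P : set (aut T)) (L : choiceType) (t : T) :
  subgroup P -> ktransitive 2 P -> (forall x : T, exists y, (x < y)%O) ->
  closed_piecewise P -> closed_disjoint P ->
  ([set: T] #<= [set: L])%card -> ([set: L] #<= continuum)%card ->
  exists H : set (aut T),
    [/\ representation_within (FreeGroup L) P H, pathological H & omega_transitive H].
Proof.
move=> Psub P2 nomax Ppiece Pdisj /card_le_injection[j j_inj] /card_le_injection[e e_inj].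
have [s s_surj] := injection_surjection t j_inj; have [t' tt'] := nomax t.
exact: (free_representation Psub P2 nomax Ppiece Pdisj e_inj s_surj tt').
Qed.

Section FromKTransitive.
Context {d : Order.disp_t} {T : orderType d} (P : set (aut T)).

(** If M were largest, shifting n+2 increasing points ending at M one step up would send a point
    below M to M, leaving no place for the image of M. *)
Lemma ktransitive_nomax n : (`I_n.+2 #<= [set: T])%card -> ktransitive n.+1 P ->
  forall x : T, exists y, (x < y)%O.
Proof.
move=> /card_leP[g] Pn M; apply: contrapT => nM.
have leM x : (x <= M)%O by rewrite leNgt; apply/negP => Mx; apply: nM; exists x.
have [h h_inj] : exists h : 'I_n.+2 -> T, injective h.
  exists (fun i : 'I_n.+2 => val (g (SigSub (mem_set (ltn_ord i : `I_n.+2 i))))) => i k /val_inj gE.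
  have [] := 'inj_g (in_setT _) (in_setT _) gE; exact: val_inj.
pose s := sort <=%O (codom h).
have ss : size s = n.+2 by rewrite size_sort size_codom card_ord.
have slt : sorted <%O s by rewrite sort_lt_sorted map_inj_uniq ?enum_uniq.
(* The last of the n+2 points is replaced by M, which need not be among them. *)
pose y i := if (i <= n)%N then nth M s i else M.
have sM i k : (i < k)%N -> (k <= n.+1)%N -> (nth M s i < nth M s k)%O.
  move=> ik kn; apply: (sorted_ltn_nth lt_trans M slt) => //; rewrite inE ss ltnS //.
  exact: leq_trans (ltnW ik) kn.
have yS i k : (i < k)%N -> (k <= n.+1)%N -> (y i < y k)%O.
  move=> ik kn; rewrite /y; case: leqP => i_n; last first.
    by have := leq_ltn_trans i_n (leq_trans ik kn); rewrite ltnn.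
  by case: leqP => _; [exact: sM|exact: lt_le_trans (sM i k ik kn) (leM _)].
have [||f _ fE] := Pn (fun i => y i) (fun i => y i.+1).
- by move=> i k ik; apply: yS => //; exact: ltnW.
- by move=> i k ik; apply: yS.
have yM : y n.+1 = M by rewrite /y ltnn.
have fyn : f (y n) = M by rewrite -yM; exact: fE ord_max.
have : (y n < M)%O by rewrite -yM; exact: yS.
by rewrite -(aut_lt f) fyn ltNge leM.
Qed.

Hypothesis nomax : forall x : T, exists y, (x < y)%O.

(** Both tuples are lengthened by a point above their last entry. *)
Lemma ktransitive_pred k : ktransitive k.+2 P -> ktransitive k.+1 P.
Proof.
have ext (a : 'I_k.+1 -> T) : {homo a : i j / (i < j)%N >-> (i < j)%O} ->
    exists2 a' : 'I_k.+2 -> T, {homo a' : i j / (i < j)%N >-> (i < j)%O} &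
      forall i, a' (lift ord_max i) = a i.
  move=> a_incr; have [M aM] := nomax (a ord_max).
  exists (fun i => if unlift ord_max i is Some j then a j else M); last first.
    by move=> i; rewrite liftK.
  move=> i j; case: (unliftP ord_max i) => [i' ->|->]; case: (unliftP ord_max j) => [j' ->|->].
  - by rewrite !lift_max; exact: a_incr.
  - move=> _; apply: le_lt_trans aM; have := leq_ord i'; rewrite leq_eqVlt.
    case/orP => [/eqP iE|ik]; last exact/ltW/a_incr.
    by have -> : i' = ord_max by exact: val_inj.
  - by rewrite lift_max ltnNge ltnW ?ltn_ord.
  - by rewrite ltnn.
move=> Pk a b /ext[a' a'_incr a'E] /ext[b' b'_incr b'E].
by have [f Pf fE] := Pk _ _ a'_incr b'_incr; exists f => // i; rewrite -a'E fE.
Qed.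

Lemma ktransitive2 n : (2 <= n)%N -> ktransitive n P -> ktransitive 2 P.
Proof.
case: n => [|[|n]] // _; elim: n => // n IH /ktransitive_pred; exact: IH.
Qed.

End FromKTransitive.

(** A real is determined by its Dedekind cut in the countable set of rationals. *)
Lemma real_card_le_continuum (R : realType) : ([set: R] #<= continuum)%card.
Proof.
pose cut (x : R) n := if unpickle n is Some q then (ratr q < x)%O else false.
have cut_inj : injective cut.
  have cut_lt x y : (x < y)%O -> cut x = cut y -> False.
    move=> /rat_in_itvoo[q]; rewrite in_itv /= => /andP[xq qy].
    move=> /(congr1 (@^~ (pickle q))); rewrite /cut pickleK qy => /(lt_trans xq).
    by rewrite ltxx.
  by move=> x y cxy; case: (ltgtP x y) => // [/cut_lt /(_ cxy)|/cut_lt /(_ (esym cxy))].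
by apply/pcard_injP; exists cut => x y _ _; exact: cut_inj.
Qed.

Local Open Scope card_scope.

Theorem theorem2p4 :
  (forall (d : Order.disp_t) (Omega : orderType d) (n : nat)
      (P : set (aut Omega)),
    `I_n.+1 #<= [set: Omega] ->
    [set: Omega] #<= continuum ->
    (2 <= n)%N ->
    subgroup P -> ktransitive n P ->
    closed_piecewise P -> closed_disjoint P ->
    forall L : choiceType,
      [set: Omega] #<= [set: L] -> [set: L] #<= continuum ->
      exists H : set (aut Omega),
        [/\ representation_within (FreeGroup L) P H,
            pathological H & ktransitive n H]) /\
  (forall P : set (aut rat), large P ->
    forall L : choiceType,
      [set: nat] #<= [set: L] -> [set: L] #<= continuum ->
      exists H : set (aut rat),
        [/\ representation_within (FreeGroup L) P H,
            pathological H & omega_transitive H]) /\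
  (forall (R : realType) (P : set (aut R)), large P ->
    forall L : choiceType,
      [set: L] #= continuum ->
      exists H : set (aut R),
        [/\ representation_within (FreeGroup L) P H,
            pathological H & omega_transitive H]).
Proof.
split=> [d Omega [//|n] P OmegaN _ n2 Psub Pn Ppiece Pdisj L OmegaL Lc|].
  have nomax := ktransitive_nomax OmegaN Pn.
  have [t _] : exists t : Omega, True.
    by have /card_leP[g] := OmegaN; exists (val (g (SigSub (mem_set (ltn0Sn _ : `I_n.+2 0%N))))).
  have [H [Hrep Hpath Homega]] := free_representation_card t Psub
    (ktransitive2 nomax n2 Pn) nomax Ppiece Pdisj OmegaL Lc.
  by exists H; split=> //; exact: Homega.
have nomax (R : realFieldType) (x : R) : exists y, (x < y)%O.
  by exists (x + 1)%R; rewrite Num.Theory.ltrDl Num.Theory.ltr01.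
split=> [P [Psub P2 _ Ppiece Pdisj] L natL Lc|R P [Psub P2 _ Ppiece Pdisj] L Lc].
  apply: (free_representation_card 0%R Psub P2 (@nomax _) Ppiece Pdisj) => //; apply: card_le_trans natL.
  by apply/pcard_injP; exists pickle => x y _ _; exact: (pcan_inj pickleK).
move: Lc; rewrite card_eq_le => /andP[Lc cL].
apply: (free_representation_card 0%R Psub P2 (@nomax _) Ppiece Pdisj _ Lc).
exact: card_le_trans (real_card_le_continuum R) cL.
Qed.
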